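(* Let $q\ge 2$, $n=n_1+n_2$, and let $$G=\begin{bmatrix}G_1&0\\ 0&G_2\end{bmatrix},\quad B=\begin{bmatrix}B_1&0\\ 0&B_2\end{bmatrix}\in\mathbb{R}^{n\times n},\quad A=\begin{bmatrix}F_1\\ -F_2\end{bmatrix}\in\mathbb{R}^{n\times q},$$ where $G_1,B_1\in\mathbb{R}^{n_1\times n_1}$ and $G_2,B_2\in\mathbb{R}^{n_2\times n_2}$ are Laplacian matrices, $F_1\in\mathbb{R}^{n_1\times q}$ and $F_2\in\mathbb{R}^{n_2\times q}$ are class-$\mathcal{F}$ matrices, and $\mathrm{rank}(A)=q$. Consider the equation $$\begin{bmatrix}G+jB&-A\\ A^{T}&0\end{bmatrix}\begin{bmatrix}E\\ Y\end{bmatrix}=\begin{bmatrix}0\\ I\end{bmatrix}$$ in the unknowns $E\in\mathbb{C}^{n\times q}$ and $Y\in\mathbb{C}^{q\times q}$, where $j=\sqrt{-1}$ and $I$ is the $q\times q$ identity. This equation admits a solution $(E,Y)$ with a unique $Y$ (that is, a solution exists and $Y$ is the same for all solutions). Moreover, the following hold. 1. $Y=Y^{T}$. 2. Each eigenvalue $\lambda$ of $Y$ satisfies $\mathrm{Re}(\lambda)\ge0$ and $\mathrm{Im}(\lambda)\ge0$. 3. $Y\mathbf{1}_q=0$. 4. If $B=0$ then $Y$ is real and $Y\ge0$.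
   Context: $\mathbf{1}_q\in\mathbb{R}^q$ is the vector of all ones; $(\cdot)^T$ is the transpose (without conjugation); $Y\ge0$ means positive semidefinite. Laplacian matrix: a real symmetric matrix with off-diagonal entries $-w_{rs}$, $w_{rs}=w_{sr}\ge0$, and diagonal entries $\sum_{s\neq r}w_{rs}$. Class $\mathcal{F}$: a matrix is class $\mathcal{F}$ if each entry is $0$ or $1$, each column contains a single nonzero entry, and there are no zero rows. These matrices come from a network of $q$ LC oscillators under bilayer coupling: $A$ is the oriented incidence matrix of the oscillators (no two columns equal up to sign), each oscillator extending between the first $n_1$ nodes (positive terminal) and the last $n_2$ nodes (negative terminal); $G$ and $B$ are the Laplacians of the resistive and inductive couplers, none of which extends between the two groups of nodes. *)

(* Defs.v *)
From mathcomp Require Import all_boot all_order all_algebra.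
From mathcomp Require Export reals complex.

Set Implicit Arguments.
Unset Strict Implicit.
Unset Printing Implicit Defensive.

Import GRing.Theory Num.Theory.
Local Open Scope ring_scope.

Definition is_laplacian (R : realType) (n : nat) (L : 'M[R]_n) : Prop :=
  exists w : 'M[R]_n,
    [/\ forall r s, w r s = w s r,
        forall r s, 0 <= w r s
      & L = \matrix_(r, s) (if r == s then \sum_(t | t != r) w r t
                            else - w r s)].

Definition is_classF (R : realType) (m q : nat) (F : 'M[R]_(m, q)) : Prop :=
  [/\ forall i k, F i k = 0 \/ F i k = 1,
      forall k, exists! i, F i k <> 0
    & forall i, row i F <> 0].

Definition is_psd (R : realType) (n : nat) (S : 'M[R]_n) : Prop :=
  S^T = S /\ forall x : 'cV[R]_n, 0 <= (x^T *m S *m x) 0 0.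

Definition cplx_mx (R : realType) (m n : nat) (M : 'M[R]_(m, n)) :
  'M[R[i]]_(m, n) := map_mx (real_complex R) M.

(* 'i%C is the imaginary unit Complex 0 1 of R[i], not the 'i of ssrnum. *)
Definition network_eq (R : realType) (n q : nat)
    (G B : 'M[R]_n) (A : 'M[R]_(n, q))
    (E : 'M[R[i]]_(n, q)) (Y : 'M[R[i]]_q) : Prop :=
  block_mx (cplx_mx G + 'i%C *: cplx_mx B) (- cplx_mx A)
           (cplx_mx A)^T                   0
    *m col_mx E Y = col_mx 0 1%:M.

(* Main.v *)
Require Import Defs.
From mathcomp Require Import all_boot all_order all_algebra.
Import GRing.Theory Num.Theory.
Local Open Scope ring_scope.

(** Write [M = G + jB].  Since [A^T E = I] and [A] is real, also [E^* A = I],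
    so [M E = A Y] gives [Y = E^* M E]; likewise [Y^T = E^T M E].  Laplacians
    satisfy [u^* L u = 1/2 sum_rs w_rs |u_r - u_s|^2], which is nonnegative and
    vanishes only if [L u = 0].  Hence [A^T u = 0] and [M u = A v] force
    [u^* M u = 0], then [G u = B u = 0], and [v = 0] as [A] has full column
    rank: this yields both uniqueness of [Y] and, by duality, solvability.
    Finally [A^T] maps the indicator of the first layer, which [M] kills, to the
    all-ones vector. *)

Set Implicit Arguments.
Unset Strict Implicit.

Local Notation "M ^cx" := (cplx_mx M) (at level 1, format "M ^cx").
Local Notation "M ^t*" := (map_mx Num.conj M)^T.

(** * Real matrices acting on complex vectors *)

Section Complexification.
Variable R : realType.
Implicit Types m n p q : nat.

Lemma cplx_mxM m n p (L : 'M[R]_(m, n)) (N : 'M[R]_(n, p)) :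
  (L *m N)^cx = L^cx *m N^cx.
Proof. exact: map_mxM. Qed.

Lemma cplx_mx_tr m n (L : 'M[R]_(m, n)) : (L^T)^cx = (L^cx)^T.
Proof. by rewrite /cplx_mx map_trmx. Qed.

Lemma conj_cplx_mx m n (L : 'M[R]_(m, n)) : map_mx Num.conj L^cx = L^cx.
Proof. by apply/matrixP=> i k; rewrite !mxE; apply: conjc_real. Qed.

Lemma conj_fixed_cplx_mx m n (Y : 'M[R[i]]_(m, n)) :
  map_mx Num.conj Y = Y -> Y = (map_mx (@complex.Re R) Y)^cx.
Proof.
move=> Yfix; apply/matrixP=> i k; rewrite !mxE.
move/matrixP/(_ i k): Yfix; rewrite !mxE; case: (Y i k) => a b /= [] bN.
congr (Complex a _); apply/eqP.
(* Being fixed by conjugation gives [- b = b], hence [b + b = 0]. *)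
by rewrite -[_ == 0](mulrn_eq0 b 2) mulr2n -{1}bN addNr.
Qed.

Lemma adjmxM m n p (X : 'M[R[i]]_(m, n)) (Z : 'M[R[i]]_(n, p)) :
  (X *m Z)^t* = Z^t* *m X^t*.
Proof. by rewrite map_mxM trmx_mul. Qed.

(** Complex vectors are used because the form is evaluated on columns of [E]. In the order of
    [R[i]], nonnegative also means real. *)
Definition definite_off_kernel n (L : 'M[R]_n) : Prop :=
  forall u : 'cV[R[i]]_n, 0 <= (u^t* *m L^cx *m u) 0 0 /\
    ((u^t* *m L^cx *m u) 0 0 = 0 -> L^cx *m u = 0).

Lemma definite_off_kernel_block m n (L : 'M[R]_m) (N : 'M[R]_n) :
  definite_off_kernel L -> definite_off_kernel N ->
  definite_off_kernel (block_mx L 0 0 N).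
Proof.
move=> hL hN u; rewrite -[u]vsubmxK; move: (usubmx u) (dsubmx u) => a b.
have [La0 LaE] := hL a; have [Nb0 NbE] := hN b.
have E : (block_mx L 0 0 N)^cx *m col_mx a b = col_mx (L^cx *m a) (N^cx *m b).
  by rewrite /cplx_mx map_block_mx !map_mx0 mul_block_col !mul0mx addr0 add0r.
rewrite -mulmxA E map_col_mx tr_col_mx mul_row_col !mulmxA mxE.
split; first exact: addr_ge0.
by move/eqP; rewrite paddr_eq0 // => /andP[/eqP/LaE-> /eqP/NbE->]; rewrite col_mx0.
Qed.

End Complexification.

(** * Laplacians as weighted sums of squared differences *)

Section Laplacian.
Variables (R : realType) (n : nat) (L : 'M[R]_n).
Hypothesis lapL : is_laplacian L.

Lemma laplacian_tr : L^T = L.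
Proof.
case: lapL => w [wC _ ->]; apply/matrixP=> r s; rewrite !mxE eq_sym.
by case: eqP => [->|_] //; rewrite wC.
Qed.

Lemma laplacian_mulE (w : 'M[R]_n) (u : 'cV[R[i]]_n) :
  L = \matrix_(r, s) (if r == s then \sum_(t | t != r) w r t else - w r s) ->
  forall r, (L^cx *m u) r 0 = \sum_s (w r s)%:C%C * (u r 0 - u s 0).
Proof.
move=> -> r; rewrite mxE (bigD1 r) //= [RHS](bigD1 r) //= subrr mulr0 add0r.
rewrite !mxE eqxx rmorph_sum mulr_suml -big_split /=.
apply: eq_bigr => s sr; rewrite !mxE eq_sym (negPf sr) rmorphN mulrBr.
by rewrite mulNr.
Qed.

Lemma laplacian_const : L *m const_mx 1 = 0 :> 'cV_n.
Proof.
case: lapL => w [_ _ ->]; apply/colP=> r; rewrite !mxE (bigD1 r) //= !mxE eqxx.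
rewrite mulr1 -big_split big1 //= => s sr.
by rewrite !mxE eq_sym (negPf sr) mulr1 subrr.
Qed.

Lemma laplacian_definite : definite_off_kernel L.
Proof.
case: lapL => w [wC w0 LE] u; have mulE := laplacian_mulE u LE.
pose e r s : R[i] := (w r s)%:C%C * `|u r 0 - u s 0| ^+ 2.
have e0 r s : 0 <= e r s by rewrite mulr_ge0 ?exprn_ge0 // lecR.
have qE : (u^t* *m L^cx *m u) 0 0 *+ 2 = \sum_r \sum_s e r s.
  have E : (u^t* *m L^cx *m u) 0 0 =
      \sum_r \sum_s (u r 0)^* * ((w r s)%:C%C * (u r 0 - u s 0)).
    rewrite -mulmxA mxE; apply: eq_bigr => r _.
    by rewrite mulE !mxE mulr_sumr.
  (* The form is doubled so that one copy can be summed with [r] and [s] exchanged; by symmetry of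
     [w] the two terms of a pair add up to [e r s]. *)
  rewrite mulr2n {2}E exchange_big E -big_split; apply: eq_bigr => r _ /=.
  rewrite -big_split; apply: eq_bigr => s _ /=.
  rewrite /e normCK rmorphB /= (wC s r).
  rewrite -[u s 0 - u r 0]opprB !mulrN mulrCA [X in _ - X]mulrCA -mulrBr -mulrBl.
  by congr (_ * _); rewrite mulrC.
have q0 : 0 <= (u^t* *m L^cx *m u) 0 0.
  by rewrite -(pmulrn_lge0 _ (isT : (0 < 2)%N)) qE !sumr_ge0 // => r _; apply: sumr_ge0.
(* Each [e r s] vanishes, so the weight is zero or the two entries of [u] agree; either way the term
   of [L u] is zero. *)
split=> // q_eq0; apply/colP=> r; rewrite mulE mxE big1 // => s _.
have : \sum_r \sum_s e r s = 0 by rewrite -qE q_eq0 mul0rn.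
move/eqP; rewrite psumr_eq0 => [/allP/(_ r (mem_index_enum r))/= /eqP|? _]; last first.
  exact: sumr_ge0.
move/eqP; rewrite psumr_eq0 => // /allP/(_ s (mem_index_enum s))/=.
rewrite /e mulf_eq0 expf_eq0 normr_eq0 /= => /orP[]/eqP->; first by rewrite mul0r.
by rewrite mulr0.
Qed.

End Laplacian.

(** The only nonzero entry of a column is 1, so each column sums to 1. *)
Lemma classF_tr_const (R : realType) m q (F : 'M[R]_(m, q)) :
  is_classF F -> F^T *m const_mx 1 = const_mx 1 :> 'cV_q.
Proof.
case=> F01 F1 _; apply/colP=> k; rewrite !mxE.
have [i [Fi uniq_i]] := F1 k; rewrite (bigD1 i) //= !mxE big1 ?addr0 => [|r ri].
  by case: (F01 i k) Fi => [->|->]; rewrite ?mulr1 // => /(_ erefl).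
rewrite !mxE mulr1; case: (F01 r k) => // Frk.
by case/eqP: ri; apply/esym/uniq_i; rewrite Frk; apply/eqP/oner_neq0.
Qed.

(** * The network equation for symmetric [G], [B] with definite forms *)

Section Network.
Variables (R : realType) (n q : nat) (G B : 'M[R]_n) (A : 'M[R]_(n, q)).
Hypotheses (symG : G^T = G) (symB : B^T = B).
Hypotheses (defG : definite_off_kernel G) (defB : definite_off_kernel B).
Hypothesis rankA : \rank A = q.

Local Notation M := (G^cx + 'i%C *: B^cx).

Lemma network_eqP E Y :
  network_eq G B A E Y <-> M *m E = A^cx *m Y /\ (A^cx)^T *m E = 1%:M.
Proof.
rewrite /network_eq mul_block_col mulNmx mul0mx addr0.
split=> [/eq_col_mx[/eqP ME AE]|[-> ->]]; last by rewrite subrr.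
by split=> //; apply/eqP; rewrite -subr_eq0.
Qed.

Lemma admittance_tr : M^T = M.
Proof. by rewrite linearD linearZ /= -!cplx_mx_tr symG symB. Qed.

(** The forms of [G] and [B] at [u] are real and nonnegative, so they are exactly the real and
    imaginary parts of [z]. *)
Lemma admittance_form (u : 'cV[R[i]]_n) :
  let z := (u^t* *m M *m u) 0 0 in
  [/\ 0 <= complex.Re z, 0 <= complex.Im z & z = 0 -> M *m u = 0].
Proof.
have [G0 GE] := defG u; have [B0 BE] := defB u => z.
have zE : z = (u^t* *m G^cx *m u) 0 0 + 'i%C * (u^t* *m B^cx *m u) 0 0.
  by rewrite /z mulmxDr mulmxDl -scalemxAr -scalemxAl mxE [X in _ + X]mxE.
move: G0 GE B0 BE; rewrite zE.
case: (_ 0 0) => a b; rewrite lecE /= => /andP[/eqP-> a0] GE.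
case: (_ 0 0) => c d; rewrite lecE /= => /andP[/eqP-> c0] BE.
have simp := (mul0r, mul1r, mulr0, addr0, add0r, subr0).
rewrite !simp; split=> // /eqP; rewrite eq_complex /= !simp.
case/andP=> /eqP a_eq0 /eqP c_eq0; rewrite mulmxDl -scalemxAl GE ?BE ?a_eq0 ?c_eq0 //.
by rewrite scaler0 addr0.
Qed.

(** Rank is preserved by extending scalars from [R] to [R[i]]. *)
Lemma cplx_incidence_inj p (V : 'M[R[i]]_(q, p)) : A^cx *m V = 0 -> V = 0.
Proof.
move=> AV0; apply: trmx_inj; rewrite trmx0.
have freeA : row_free (A^cx)^T by rewrite /row_free mxrank_tr mxrank_map rankA.
by apply: (row_free_inj freeA); rewrite mul0mx -trmx_mul AV0 trmx0.
Qed.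

(** The width [p] is free: uniqueness takes a difference of solutions, solvability a cokernel
    matrix. *)
Lemma network_kernel p (U : 'M[R[i]]_(n, p)) (V : 'M[R[i]]_(q, p)) :
  M *m U = A^cx *m V -> (A^cx)^T *m U = 0 -> V = 0.
Proof.
move=> MU AU; apply: cplx_incidence_inj; rewrite -MU.
apply/matrixP=> i k; have Mcol : M *m col k U = A^cx *m col k V.
  by rewrite !colE !mulmxA MU.
(* Conjugating [A^T U = 0] is harmless as [A] is real; this makes the form of [M] vanish at each
   column of [U]. *)
have UA : (col k U)^t* *m A^cx = 0.
  apply: trmx_inj; rewrite trmx_mul trmxK trmx0 -conj_cplx_mx map_trmx -map_mxM.
  by rewrite colE mulmxA AU mul0mx map_mx0.
have MUk0 : M *m col k U = 0.
  have [_ _] := admittance_form (col k U).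
  by apply; rewrite -mulmxA Mcol mulmxA UA mul0mx mxE.
have -> : (M *m U) i k = (M *m col k U) i 0 by rewrite colE mulmxA -colE [RHS]mxE.
by rewrite MUk0 !mxE.
Qed.

Lemma network_unique E E' Y Y' :
  network_eq G B A E Y -> network_eq G B A E' Y' -> Y' = Y.
Proof.
move=> /network_eqP[ME AE] /network_eqP[ME' AE']; apply/eqP; rewrite -subr_eq0.
apply/eqP/(@network_kernel _ (E' - E)); rewrite mulmxBr; first by rewrite ME' ME mulmxBr.
by rewrite AE AE' subrr.
Qed.

Lemma network_solvable : exists E Y, network_eq G B A E Y.
Proof.
pose K := block_mx M (- A^cx) (A^cx)^T 0.
pose C : 'M[R[i]]_(n + q, q) := col_mx 0 1%:M.
(* Fredholm alternative: [K Z = C] is solvable once every [D] with [K^T D = 0] satisfies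
   [C^T D = 0]. *)
suff /submxP[X CE] : (C^T <= K^T)%MS.
  exists (usubmx X^T), (dsubmx X^T); rewrite /network_eq vsubmxK.
  by apply: trmx_inj; rewrite trmx_mul trmxK.
rewrite submxE; have := mulmx_coker K^T; move: (cokermx _) => D.
rewrite -[D]vsubmxK; move: (usubmx D) (dsubmx D) => U V.
rewrite tr_block_mx tr_col_mx !trmx0 trmx1 trmxK linearN /= admittance_tr.
rewrite mul_block_col mul_row_col !mul0mx addr0 add0r mul1mx mulNmx.
rewrite -[RHS]col_mx0 => /eq_col_mx[MU AU].
(* As [M] is symmetric, transposing [K] only flips the signs of the blocks of [A], so the kernel
   lemma applies to the pair [U], [- V]. *)
rewrite -oppr_eq0; apply/eqP/(@network_kernel _ U); last first.
  by apply/eqP; rewrite -oppr_eq0 AU.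
by apply/eqP; rewrite mulmxN -addr_eq0 MU.
Qed.

Section Solution.
Variables (E : 'M[R[i]]_(n, q)) (Y : 'M[R[i]]_q).
Hypothesis solEY : network_eq G B A E Y.

Lemma network_tr : Y^T = Y.
Proof.
have [ME AE] := proj1 (network_eqP E Y) solEY.
have -> : Y = E^T *m M *m E.
  by rewrite -mulmxA ME mulmxA -[A^cx]trmxK -trmx_mul AE trmx1 mul1mx.
by rewrite !trmx_mul admittance_tr trmxK mulmxA.
Qed.

Lemma network_adjE : Y = E^t* *m M *m E.
Proof.
have [ME AE] := proj1 (network_eqP E Y) solEY.
rewrite -mulmxA ME mulmxA -[A^cx]trmxK -trmx_mul -conj_cplx_mx map_trmx.
by rewrite -map_mxM AE map_mx1 trmx1 mul1mx.
Qed.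

Lemma network_form (x : 'cV[R[i]]_q) :
  (x^t* *m Y *m x) 0 0 = ((E *m x)^t* *m M *m (E *m x)) 0 0.
Proof. by rewrite network_adjE adjmxM !mulmxA. Qed.

Lemma network_eigenvalue l : eigenvalue Y l ->
  0 <= complex.Re l /\ 0 <= complex.Im l.
Proof.
case/eigenvalueP=> v vY v_neq0.
(* [eigenvalue] provides a left eigenvector; symmetry of [Y] turns it into a right one. *)
have Yv : Y *m v^T = l *: v^T by rewrite -{1}network_tr -trmx_mul vY linearZ.
have vv : exists2 r : R, 0 < r & ((v^T)^t* *m v^T) 0 0 = r%:C%C.
  have vv0 : 0 < ((v^T)^t* *m v^T) 0 0.
    have E0 k : 0 <= (v^T)^t* 0 k * v^T k 0 by rewrite !mxE mulrC mul_conjC_ge0.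
    rewrite mxE lt0r sumr_ge0 // andbT; apply: contra v_neq0.
    rewrite psumr_eq0 // => /allP v0; apply/eqP/rowP=> k.
    move: (v0 k (mem_index_enum k)); rewrite !mxE mulrC mul_conjC_eq0.
    exact: eqP.
  exists (complex.Re (((v^T)^t* *m v^T) 0 0)); move: vv0; case: (_ 0 0) => a b.
    by rewrite ltcE => /andP[].
  by rewrite ltcE /= => /andP[/eqP-> _].
have [r r0 vvE] := vv.
(* The form of [M] at [E v^T] equals [l] times the positive real [r], so its signs pass to both
   parts of [l]. *)
have [] := admittance_form (E *m v^T); rewrite -network_form -mulmxA Yv.
rewrite -scalemxAr mxE vvE; case: l {vY Yv} => a b /=.
by rewrite !mulr0 subr0 add0r !pmulr_lge0.
Qed.

(** By symmetry of [Y] and [M], [Y x = (A Y)^T u = (M E)^T u = E^T M u = 0]. *)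
Lemma network_ker (u : 'cV[R[i]]_n) (x : 'cV[R[i]]_q) :
  M *m u = 0 -> (A^cx)^T *m u = x -> Y *m x = 0.
Proof.
have [ME AE] := proj1 (network_eqP E Y) solEY.
move=> Mu <-; rewrite -network_tr mulmxA -trmx_mul -ME trmx_mul admittance_tr.
by rewrite -mulmxA Mu mulmx0.
Qed.

End Solution.
End Network.

(** * The purely resistive case *)

(** Without [B] all coefficients are real. Uniqueness of [Y] then forces it to equal its
    conjugate. *)
Lemma network_eq_conj (R : realType) n q (G : 'M[R]_n) (A : 'M[R]_(n, q)) E Y :
  network_eq G 0 A E Y ->
  network_eq G 0 A (map_mx Num.conj E) (map_mx Num.conj Y).
Proof.
move/network_eqP; rewrite /cplx_mx map_mx0 scaler0 addr0 => -[ME AE].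
apply/network_eqP; rewrite /cplx_mx map_mx0 scaler0 addr0.
move: (congr1 (map_mx Num.conj) ME) (congr1 (map_mx Num.conj) AE).
by rewrite !map_mxM -map_trmx map_mx1 !conj_cplx_mx.
Qed.

Lemma network_resistive (R : realType) n q (G : 'M[R]_n) (A : 'M[R]_(n, q)) E Y :
  G^T = G -> definite_off_kernel G -> \rank A = q -> network_eq G 0 A E Y ->
  exists Yr : 'M[R]_q, Y = cplx_mx Yr /\ is_psd Yr.
Proof.
move=> symG defG rankA sol.
have sym0 : (0 : 'M[R]_n)^T = 0 by rewrite trmx0.
have def0 : definite_off_kernel (0 : 'M[R]_n).
  by move=> u; rewrite /cplx_mx map_mx0 mulmx0 !mul0mx mxE.
have Yreal : map_mx Num.conj Y = Y.
  exact: (network_unique defG def0 rankA sol (network_eq_conj sol)).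
have YE := conj_fixed_cplx_mx Yreal.
exists (map_mx (@complex.Re R) Y); split=> //; split=> [|x].
  by rewrite map_trmx (network_tr symG sym0 sol).
(* For real [x], the form of [Y] at [x] is that of [M] at [E x], whose real part is nonnegative. *)
have [+ _ _] := admittance_form defG def0 (E *m x^cx).
rewrite -(network_form sol) {1}YE conj_cplx_mx -cplx_mx_tr -!cplx_mxM.
by rewrite [X in complex.Re X]mxE.
Qed.

Unset Implicit Arguments.

Theorem theorem2 (R : realType) (q n1 n2 : nat)
    (G1 B1 : 'M[R]_n1) (G2 B2 : 'M[R]_n2)
    (F1 : 'M[R]_(n1, q)) (F2 : 'M[R]_(n2, q))
    (G B : 'M[R]_(n1 + n2)) (A : 'M[R]_(n1 + n2, q))
    (hq : (2 <= q)%N)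
    (hG : G = block_mx G1 0 0 G2)
    (hB : B = block_mx B1 0 0 B2)
    (hA : A = col_mx F1 (- F2))
    (hG1 : is_laplacian G1) (hG2 : is_laplacian G2)
    (hB1 : is_laplacian B1) (hB2 : is_laplacian B2)
    (hF1 : is_classF F1) (hF2 : is_classF F2)
    (hrank : \rank A = q) :
  exists Y : 'M[R[i]]_q,
    (exists E, network_eq G B A E Y) /\
    (forall E' Y', network_eq G B A E' Y' -> Y' = Y) /\
    Y = Y^T /\
    (forall lambda : R[i], eigenvalue Y lambda ->
       0 <= complex.Re lambda /\ 0 <= complex.Im lambda) /\
    Y *m (const_mx 1 : 'cV[R[i]]_q) = 0 /\
    (B = 0 -> exists Yr : 'M[R]_q, Y = cplx_mx Yr /\ is_psd Yr).
Proof.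
have symG : G^T = G by rewrite hG tr_block_mx !trmx0 !laplacian_tr.
have symB : B^T = B by rewrite hB tr_block_mx !trmx0 !laplacian_tr.
have defG : definite_off_kernel G.
  by rewrite hG; apply: definite_off_kernel_block; apply: laplacian_definite.
have defB : definite_off_kernel B.
  by rewrite hB; apply: definite_off_kernel_block; apply: laplacian_definite.
have [E [Y sol]] := network_solvable symG symB defG defB hrank.
exists Y; split; first by exists E.
split; first by move=> E' Y'; apply: network_unique sol.
split; first by rewrite (network_tr symG symB sol).
split; first by move=> l; apply: network_eigenvalue sol l.
split; last by move=> B0; move: sol; rewrite B0; apply: network_resistive.
pose u : 'cV[R]_(n1 + n2) := col_mx (const_mx 1) 0.
have layer_ker L N : is_laplacian L -> (block_mx L 0 0 N)^cx *m u^cx = 0.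
  move=> lapL; rewrite -cplx_mxM mul_block_col !mulmx0 !mul0mx !addr0.
  by rewrite laplacian_const // col_mx0 /cplx_mx map_mx0.
apply: (network_ker symG symB sol (u := u^cx)).
  by rewrite mulmxDl -scalemxAl hG hB !layer_ker // scaler0 addr0.
(* The zero lower block of [u] removes [F2], leaving the column sums of [F1]. *)
rewrite -cplx_mx_tr -cplx_mxM hA tr_col_mx mul_row_col mulmx0 addr0.
by rewrite classF_tr_const // /cplx_mx map_const_mx.
Qed.
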